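(* Let $y\in L^2([0,1]^2)$ and let $x^\dagger$ be a non-negative factored solution to the autoconvolution equation $F(x)=y$ in the limited data case which satisfies $0\in\operatorname{supp}(x^\dagger)$. Then there are no other non-negative factored solutions in the limited data case; that is, if $x$ is a non-negative factored solution to $F(x)=y$ in the limited data case, then $x=x^\dagger$ almost everywhere on $[0,1]^2$.
   Context: All functions are real-valued, and $L^2$ spaces are with respect to Lebesgue measure $\lambda$. A function in $L^2([0,1]^2)$ (respectively $L^2([0,1])$) is regarded as an element of $L^2(\mathbb{R}^2)$ (respectively $L^2(\mathbb{R})$) with essential support in $[0,1]^2$ (respectively $[0,1]$) by extending it by zero. The limited data autoconvolution operator $F$ is $F(x)=x*x$ restricted to $[0,1]^2$, i.e. for $0\le s_1,s_2\le1$ $$[F(x)](s_1,s_2)=\int_0^{s_2}\int_0^{s_1}x(s_1-t_1,s_2-t_2)\,x(t_1,t_2)\,dt_1\,dt_2 .$$ For given $y\in L^2([0,1]^2)$, a solution to $F(x)=y$ in the limited data case is a function $x\in L^2([0,1]^2)$ with $\operatorname{supp}(x)\subseteq[0,1]^2$ such that $[x*x](s_1,s_2)=y(s_1,s_2)$ for almost every $(s_1,s_2)\in[0,1]^2$. Such a solution is called a factored solution if it has the structure $x(t_1,t_2)=x_1(t_1)\,x_2(t_2)$ $(0\le t_1,t_2\le1)$ with $x_i\in L^2([0,1])$, $\operatorname{supp}(x_i)\subseteq[0,1]$ for $i=1,2$; it is called a non-negative factored solution if moreover $x_i\ge0$ almost everywhere on $[0,1]$ for $i=1$ and $i=2$.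 Here $0$ denotes the origin of $\mathbb{R}^2$, and $0\in\operatorname{supp}(x)$ means that for every radius $r>0$ there is a measurable set $M_r\subset B_r(0)\cap[0,1]^2$ with $\lambda(M_r)>0$ such that $x(t_1,t_2)\neq0$ for almost every $(t_1,t_2)\in M_r$, where $B_r(0)$ is the ball of radius $r$ around the origin. *)

(* Defs.v *)
From HB Require Import structures.
From mathcomp Require Import all_boot all_order all_algebra.
From mathcomp Require Import all_classical all_reals all_analysis.

Set Implicit Arguments.
Unset Strict Implicit.
Unset Printing Implicit Defensive.

Import Order.TTheory GRing.Theory Num.Theory.
Import numFieldNormedType.Exports.

Local Open Scope classical_set_scope.
Local Open Scope ring_scope.

Notation leb1 R := (@lebesgue_measure R).

Notation leb2 R := (@lebesgue_measure R \x @lebesgue_measure R)%E.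

Definition unit_interval (R : realType) : set R := `[0, 1].

Definition unit_square (R : realType) : set (R * R) := `[0, 1] `*` `[0, 1].

(* Essential support: the complement of the union of all open sets on which f
   vanishes almost everywhere. *)
Definition ess_supp1 (R : realType) (f : R -> R) : set R :=
  ~` \bigcup_(U in [set U | open U /\ f = cst 0 %[ae leb1 R in U]]) U.

Definition ess_supp2 (R : realType) (f : R * R -> R) : set (R * R) :=
  ~` \bigcup_(U in [set U | open U /\ f = cst 0 %[ae leb2 R in U]]) U.

(* Elements of L^2([0,1]) and L^2([0,1]^2) are represented by functions on the
   whole line or plane, extended by zero.  Lfun asks for a Borel measurable
   function; every Lebesgue class has such a representative. *)
Definition L2_interval (R : realType) (f : R -> R) : Prop :=
  f \in Lfun (leb1 R) 2%:E /\ ess_supp1 f `<=` @unit_interval R.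

Definition L2_square (R : realType) (f : R * R -> R) : Prop :=
  f \in Lfun (leb2 R) 2%:E /\ ess_supp2 f `<=` @unit_square R.

(* Only the values on the unit square are used. *)
Definition autoconv (R : realType) (x : R * R -> R) (s : R * R) : R :=
  \int[leb1 R]_(t2 in `[0, s.2]) \int[leb1 R]_(t1 in `[0, s.1])
    (x (s.1 - t1, s.2 - t2) * x (t1, t2)).

Definition limited_data_solution (R : realType) (y x : R * R -> R) : Prop :=
  L2_square x /\ autoconv x = y %[ae leb2 R in @unit_square R].

Definition factorization (R : realType) (x : R * R -> R) (x1 x2 : R -> R) :
    Prop :=
  [/\ L2_interval x1, L2_interval x2 &
      x = (fun t => x1 t.1 * x2 t.2) %[ae leb2 R in @unit_square R]].

Definition ae_nonneg (R : realType) (f : R -> R) : Prop :=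
  \forall t \ae leb1 R, @unit_interval R t -> 0 <= f t.

Definition nonneg_factored_solution (R : realType) (y x : R * R -> R) : Prop :=
  limited_data_solution y x /\
  exists x1 x2, [/\ factorization x x1 x2, ae_nonneg x1 & ae_nonneg x2].

(* Euclidean disc; the library's ball on R * R is the one of the max norm. *)
Definition disc0 (R : realType) (r : R) : set (R * R) :=
  [set t | t.1 ^+ 2 + t.2 ^+ 2 < r ^+ 2].

Definition origin_in_supp (R : realType) (x : R * R -> R) : Prop :=
  forall r : R, 0 < r ->
    exists M : set (R * R),
      [/\ measurable M, M `<=` disc0 r `&` @unit_square R,
          (0 < leb2 R M)%E &
          \forall t \ae leb2 R, M t -> x t != 0].

(* Main.v *)
(** Write a solution as a product of non-negative [a1], [a2] supported in [0,
1]; its autoconvolution on the unit square is [(a1 * a1) (s1) (a2 * a2) (s2)],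
so integrating against [exp (- p s1 - q s2)] determines the product of the one-
dimensional transforms of [a1 * a1] and [a2 * a2] over [0, 1].  Separation of
variables gives, for two solutions, [a1 * a1 = c (d1 * d1)] at the level of
these transforms.  Truncating to [0, 1] changes the transform of [a * a] at
[n], which is the square of the Laplace transform [A n] of [a], by [O (exp (-
n))]; hence [(A n - sqrt c D n) (A n + sqrt c D n) = O (exp (- n))].  As [d >=
0] charges every neighbourhood of 0, [D n >= eta exp (- n e)] for every [e >
0], so the Laplace transform of [a - sqrt c d] decays like [exp (- n (1 - e))].
This forces [a = sqrt c d] a.e. on [0, 1 - e]: non-negativity replaces
Titchmarsh's theorem by this one-sided uniqueness statement. *)

Require Import Defs.
From mathcomp Require Import all_boot all_order all_algebra.
From mathcomp Require Import all_classical all_reals all_analysis.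
From mathcomp Require Import measurable_realfun.
From mathcomp Require Import ring lra.

Import Order.TTheory GRing.Theory Num.Theory.
Import numFieldNormedType.Exports.

Local Open Scope classical_set_scope.
Local Open Scope ring_scope.

(** * Invariance of Lebesgue integrals under reflections and translations *)

Section reflection.
Context {R : realType}.
Local Notation mu := (@lebesgue_measure R).

Lemma measurable_reflect (c : R) :
  measurable_fun [set: R] (fun t : R => c - t : measurableTypeR R).
Proof. exact: measurable_funB. Qed.

(** Lebesgue measure is determined by its values on half-open intervals. The reflection turns []a,
    b]] into [[c - b, c - a[], which is half-open on the other side but has the same length. *)
Lemma lebesgue_measure_reflect (c : R) (A : set R) : measurable A ->
  mu ((fun t => c - t) @^-1` A) = mu A.
Proof.
move=> mA; pose phi : measurableTypeR R -> measurableTypeR R := fun t => c - t.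
have mphi : measurable_fun setT phi by exact: measurable_reflect.
pose nu := pushforward mu phi.
apply/esym; rewrite (@lebesgue_measure_unique _ nu)// => _ [[a b]] _ <-.
rewrite /nu/= /pushforward.
have -> : phi @^-1` `]a, b]%classic = `[c - b, c - a[%classic.
  apply/seteqP; split => t/=; rewrite /phi/= !in_itv/=; lra.
rewrite !lebesgue_measure_itv/= !lte_fin.
have -> : (c - b < c - a) = (a < b) by apply/idP/idP; lra.
by case: ifPn => // _; rewrite -!EFinB; congr EFin; lra.
Qed.

Local Open Scope ereal_scope.

Lemma ge0_integral_reflect (c : R) (f : R -> \bar R) :
  measurable_fun setT f -> (forall t, 0 <= f t) ->
  \int[mu]_t f (c - t)%R = \int[mu]_t f t.
Proof.
move=> mf f0; pose phi : measurableTypeR R -> measurableTypeR R := fun t => (c - t)%R.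
have mphi : measurable_fun setT phi by exact: measurable_reflect.
transitivity (\int[pushforward mu phi]_t f t).
  have := @ge0_integral_pushforward _ _ _ _ _ phi mphi mu setT f measurableT mf.
  by rewrite preimage_setT => ->.
apply: eq_measure_integral => A mA _; exact: lebesgue_measure_reflect.
Qed.

(** The reflections about 0 and [c] compose to the translation, since [0 - (c - t) = t - c]. *)
Lemma ge0_integral_translate (c : R) (f : R -> \bar R) :
  measurable_fun setT f -> (forall t, 0 <= f t) ->
  \int[mu]_t f (t - c)%R = \int[mu]_t f t.
Proof.
move=> mf f0; rewrite -(ge0_integral_reflect 0 f)//.
rewrite -(ge0_integral_reflect c (fun t => f (0 - t)%R))//.
  by apply: eq_integral => t _; congr f; rewrite sub0r opprB.
exact: measurableT_comp (measurable_reflect 0).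
Qed.

End reflection.

(** * Autoconvolution on the line and its Laplace transform *)

Section autoconvolution.
Context {R : realType}.
Local Notation mu := (@lebesgue_measure R).
Local Open Scope ereal_scope.

(** Extended values let Tonelli's theorem apply to non-negative [a] before any finiteness is known.
    Integration runs over the whole line; for [a] vanishing on the negative half-line this is the
    usual integral over [0, s]. *)
Definition conv (a : R -> R) (s : R) : \bar R :=
  \int[mu]_t (a (s - t) * a t)%:E.

Definition laplace (a : R -> R) (p : R) : \bar R :=
  \int[mu]_t (a t * expR (- (p * t)))%:E.

Lemma measurable_expRM (p : R) :
  measurable_fun [set: R] (fun t : R => expR (- (p * t))).
Proof.
apply: measurableT_comp; first exact: measurable_expR.
apply: measurableT_comp; first exact: oppr_measurable.
exact: mulrl_measurable.
Qed.

Lemma measurable_conv_integrand (a : R -> R) : measurable_fun setT a ->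
  measurable_fun setT (fun z : R * R => a (z.1 - z.2) * a z.2)%R.
Proof.
move=> ma; apply: measurable_funM.
  apply: measurableT_comp => //; apply: measurable_funB.
    exact: measurable_fst.
  exact: measurable_snd.
by apply: measurableT_comp => //; exact: measurable_snd.
Qed.

Lemma measurable_conv_section (a : R -> R) (s : R) : measurable_fun setT a ->
  measurable_fun setT (fun t : R => a (s - t) * a t)%R.
Proof.
move=> ma; have /= := @measurable_fun_pair2 _ _ _ _ _ _ _ s
  (measurable_conv_integrand _ ma).
exact.
Qed.

Lemma measurable_conv (a : R -> R) : measurable_fun setT a ->
  (forall t, 0 <= a t)%R -> measurable_fun setT (conv a).
Proof.
move=> ma a0.
apply: (@measurable_fun_fubini_tonelli_F _ _ _ _ _ mu
  (fun z : measurableTypeR R * measurableTypeR R => (a (z.1 - z.2) * a z.2)%:E)).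
  by apply/measurable_EFinP; exact: measurable_conv_integrand.
by move=> z; rewrite lee_fin mulr_ge0.
Qed.

Lemma conv_ge0 (a : R -> R) s : (forall t, 0 <= a t)%R -> 0 <= conv a s.
Proof. by move=> a0; apply: integral_ge0 => t _; rewrite lee_fin mulr_ge0. Qed.

Lemma laplace_ge0 (a : R -> R) p : (forall t, 0 <= a t)%R -> 0 <= laplace a p.
Proof.
by move=> a0; apply: integral_ge0 => t _; rewrite lee_fin mulr_ge0 ?expR_ge0.
Qed.

(** The convolution theorem: split [exp (- p s)] as [exp (- p (s - t)) exp (- p t)], exchange the
    integrals by Tonelli, and translate the inner one by [t]. *)
Lemma laplace_conv (a : R -> R) (p : R) : measurable_fun setT a ->
  (forall t, 0 <= a t)%R ->
  \int[mu]_s ((expR (- (p * s)))%:E * conv a s) = laplace a p * laplace a p.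
Proof.
move=> ma a0.
pose g (z : measurableTypeR R * measurableTypeR R) :=
  (expR (- (p * z.1)) * (a (z.1 - z.2) * a z.2))%:E.
have mg : measurable_fun setT g.
  apply/measurable_EFinP; apply: measurable_funM.
    apply: (@measurableT_comp _ _ _ _ _ _ (fun t : R => expR (- (p * t)))).
      exact: measurable_expRM.
    exact: measurable_fst.
  exact: measurable_conv_integrand.
have g0 z : 0 <= g z by rewrite lee_fin !mulr_ge0 ?expR_ge0.
transitivity (\int[mu]_s \int[mu]_t g (s, t)).
  apply: eq_integral => s _; rewrite -ge0_integralZl//=.
  - by apply/measurable_EFinP; exact: measurable_conv_section.
  - by move=> t _; rewrite lee_fin mulr_ge0.
rewrite (fubini_tonelli g)//.
have L0 := laplace_ge0 a p a0.
have me : measurable_fun setT (fun t : R => a t * expR (- (p * t)))%R.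
  by apply: measurable_funM => //; exact: measurable_expRM.
transitivity (\int[mu]_t ((a t * expR (- (p * t)))%:E * laplace a p)).
  apply: eq_integral => t _.
  rewrite /laplace -(ge0_integral_translate t); last 2 first.
  - exact/measurable_EFinP.
  - by move=> ?; rewrite lee_fin mulr_ge0 ?expR_ge0.
  rewrite -ge0_integralZl//=.
  - apply: eq_integral => s _; rewrite /g/= -EFinM; congr EFin.
    have -> : (- (p * s) = - (p * (s - t)) + - (p * t))%R by ring.
    rewrite expRD; ring.
  - apply/measurable_EFinP; apply: (measurableT_comp me).
    exact: measurable_funB.
  - by move=> s _; rewrite lee_fin mulr_ge0 ?expR_ge0.
  - by rewrite lee_fin mulr_ge0 ?expR_ge0.
rewrite ge0_integralZr//.
- exact/measurable_EFinP.
- by move=> s _; rewrite lee_fin mulr_ge0 ?expR_ge0.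
Qed.

End autoconvolution.

(** * Vanishing on an initial interval from exponential decay of the Laplace transform *)

Section phragmen.
Context {R : realType}.
Local Notation mu := (@lebesgue_measure R).

Lemma bernoulli_le (q : R) m : 0 <= q <= 1 -> 1 - m%:R * q <= (1 - q) ^+ m.
Proof.
move=> /andP[q0 q1]; elim: m => [|m IH]; first by rewrite expr0 mul0r subr0.
have p1 : (1 - q) ^+ m <= 1 by apply: exprn_ile1; lra.
rewrite exprS mulrBl mul1r -natr1; nra.
Qed.

(* The kernel [(1 - exp (- n t)) ^ m], [m = floor (exp (n tau))], tends to the
   indicator of [tau < t]; being a polynomial in [exp (- n t)], it is integrated
   against [f] through the moments of [f] at multiples of [n]. *)
Lemma kernel_bound (tau t : R) n : 0 <= t ->
  `|(1 - expR (- (n%:R * t))) ^+ (Num.truncn (expR (n%:R * tau)))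
    - (tau < t)%R%:R| <= expR (- (n%:R * `|t - tau|)).
Proof.
move=> t0; set q := expR (- (n%:R * t)); set m := Num.truncn _.
have q0 : 0 <= q by exact: expR_ge0.
have q1 : q <= 1 by rewrite -expR0 ler_expR oppr_le0 mulr_ge0.
have /andP[mle mlt] : m%:R <= expR (n%:R * tau) < m.+1%:R.
  by apply: truncn_itv; exact: expR_ge0.
have Em : expR (n%:R * tau) * q = expR (n%:R * (tau - t)).
  by rewrite -expRD; congr expR; ring.
have p0 : 0 <= (1 - q) ^+ m by apply: exprn_ge0; lra.
have p1 : (1 - q) ^+ m <= 1 by apply: exprn_ile1; lra.
have [ltt|tle] := ltP tau t.
  (* To the right of [tau], Bernoulli's inequality bounds [1 - (1 - q) ^ m] by [m q], hence by
     [exp (n (tau - t))]. *)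
  rewrite mulr1n distrC ger0_norm ?subr_ge0// ger0_norm; last lra.
  have -> : - (n%:R * (t - tau)) = n%:R * (tau - t) by ring.
  rewrite -Em; have := @bernoulli_le q m; rewrite q0 q1 => /(_ isT).
  have := ler_wpM2r q0 mle; lra.
rewrite mulr0n subr0 (ger0_norm p0) distrC ger0_norm ?subr_ge0//.
apply: (@le_trans _ _ (expR (- q) ^+ m)).
  apply: lerXn2r; rewrite ?nnegrE ?expR_ge0//; first lra.
  exact: expR_ge1Dx.
(* It remains to see [m q >= n (tau - t)]. From [(m + 1) q >= exp (n (tau - t)) >= 1 + n (tau - t)],
   the unit lost by truncation costs [q <= 1], which the summand 1 pays for. *)
rewrite -expRM_natl ler_expR.
have H : expR (n%:R * tau) * q <= (m%:R + 1) * q.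
  by apply: ler_wpM2r => //; rewrite natr1 ltW.
have := expR_ge1Dx (n%:R * (tau - t)); rewrite -Em.
lra.
Qed.

Lemma integrableM_unit (f g : R -> R) :
  mu.-integrable setT (EFin \o f) -> (forall t, t < 0 -> f t = 0) ->
  measurable_fun setT g -> (forall t, 0 <= t -> `|g t| <= 1) ->
  mu.-integrable setT (EFin \o (fun t => f t * g t)).
Proof.
move=> fi f0 mg g1; apply: (le_integrable measurableT _ _ fi).
  apply/measurable_EFinP; apply: measurable_funM => //.
  apply/measurable_EFinP; exact: measurable_int fi.
move=> t _; rewrite /= lee_fin normrM.
have [/f0 ->|/g1 h] := ltP t 0; first by rewrite normr0 mul0r.
by rewrite ler_piMr.
Qed.

(** A real-valued Laplace transform, usable for signed [f]. At [p = j n] it is the moment of order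
    [j] in the variable [exp (- n t)]. *)
Definition moment (f : R -> R) (p : R) : R :=
  \int[mu]_t (f t * expR (- (p * t))).

Let q (n : nat) (t : R) : R := expR (- (n%:R * t)).

Let q0 n t : 0 <= q n t. Proof. exact: expR_ge0. Qed.

Let q1 n t : 0 <= t -> q n t <= 1.
Proof. by move=> t0; rewrite -expR0 ler_expR oppr_le0 mulr_ge0. Qed.

Let measurable_kernel n j m :
  measurable_fun setT (fun t : R => q n t ^+ j * (1 - q n t) ^+ m).
Proof.
have mq : measurable_fun setT (q n) by exact: measurable_expRM.
apply: measurable_funM; first exact: measurable_funX.
by apply: measurable_funX; exact: measurable_funB.
Qed.

Let kernel_le1 n j m t : 0 <= t -> `|q n t ^+ j * (1 - q n t) ^+ m| <= 1.
Proof.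
move=> t0; have := q0 n t; have := @q1 n t t0 => h1 h0.
rewrite normrM !normrX (ger0_norm h0) ger0_norm; last lra.
by rewrite mulr_ile1 ?exprn_ge0 ?exprn_ile1//; lra.
Qed.

(** With [r = exp (- n T)], the moment of order [j] in [exp (- n t)] is at most [K r ^ j] in
    absolute value. Expanding the kernel by the binomial theorem and dropping the term [j = 0]
    leaves the binomial sum [K ((1 + r) ^ m - 1)]. The expansion is carried out by recursion on [m]
    through the mixed integrals [I j m]. *)
Lemma moment_kernel_bound (f : R -> R) (K T : R) n m :
  mu.-integrable setT (EFin \o f) -> (forall t, t < 0 -> f t = 0) ->
  (forall n : nat, `|moment f n%:R| <= K * expR (- (n%:R * T))) ->
  `|\int[mu]_t (f t * (1 - q n t) ^+ m) - \int[mu]_t f t| <=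
    K * ((1 + expR (- (n%:R * T))) ^+ m - 1).
Proof.
move=> fi f0 Kf; set r := expR (- (n%:R * T)).
have r0 : 0 <= r by exact: expR_ge0.
pose I j m := \int[mu]_t (f t * (q n t ^+ j * (1 - q n t) ^+ m)).
have Ii j m' := integrableM_unit f _ fi f0 (measurable_kernel n j m')
  (@kernel_le1 n j m').
have IS j m' : I j m'.+1 = I j m' - I j.+1 m'.
  rewrite /I -RintegralB//; apply: eq_Rintegral => t _.
  rewrite !exprS; ring.
have I0 j : `|I j 0%N| <= K * r ^+ j.
  have -> : I j 0%N = moment f (j * n)%:R.
    apply: eq_Rintegral => t _; rewrite expr0 mulr1 /q -expRM_natl.
    by congr (_ * expR _); rewrite natrM; ring.
  rewrite (le_trans (Kf _))// /r -expRM_natl.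
  suff -> : - ((j * n)%:R * T) = j%:R * - (n%:R * T) by [].
  by rewrite natrM; ring.
(* The bound is needed for all [j] at once, because the recursion lowers the second index while
   raising the first. *)
have IJ m' : forall j, `|I j m'| <= K * r ^+ j * (1 + r) ^+ m'.
  elim: m' => [|m' IH] j; first by rewrite expr0 mulr1.
  rewrite IS (le_trans (ler_normB _ _))//.
  have := IH j; have := IH j.+1; rewrite !exprS; lra.
have -> : \int[mu]_t f t = I 0%N 0%N.
  by apply: eq_Rintegral => t _; rewrite !expr0 !mulr1.
have -> : \int[mu]_t (f t * (1 - q n t) ^+ m) = I 0%N m.
  by apply: eq_Rintegral => t _; rewrite expr0 mul1r.
elim: m => [|m IH]; first by rewrite subrr normr0 expr0 subrr mulr0.
have -> : I 0%N m.+1 - I 0%N 0%N = (I 0%N m - I 0%N 0%N) - I 1%N m.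
  by rewrite IS; ring.
rewrite (le_trans (ler_normB _ _))//.
have := IJ m 1%N; rewrite expr1 !exprS; lra.
Qed.

Lemma cvg_geometric_bound (u : R ^nat) (l C z : R) : `|z| < 1 ->
  (forall n, `|u n - l| <= C * z ^+ n) -> u n @[n --> \oo] --> l.
Proof.
move=> z1 uC; apply: (@cvg_sub0 _ _ _ _ _ _ (cst l)); last exact: cvg_cst.
apply: norm_cvg0; apply: (squeeze_cvgr _ (cvg_cst 0) (cvg_geometric C z1)).
by near=> n; rewrite normr_ge0/=; exact: uC.
Unshelve. all: by end_near. Qed.

(** The integrals of [f] against the kernels have two limits. Dominated convergence, with dominating
    function [|f|], gives the integral of [f] over [t > tau]; the moment bound gives the integral of
    [f] over the line. The difference, the integral up to [tau], is therefore 0. *)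
Lemma moment_tail_eq (f : R -> R) (K T tau : R) :
  mu.-integrable setT (EFin \o f) -> (forall t, t < 0 -> f t = 0) ->
  (forall n : nat, `|moment f n%:R| <= K * expR (- (n%:R * T))) ->
  tau < T -> \int[mu]_(t in `]-oo, tau]) f t = 0.
Proof.
move=> fi f0 Kf tT.
have mf : measurable_fun setT f by apply/measurable_EFinP; exact: measurable_int fi.
have K0 : 0 <= K.
  have := Kf 0%N; rewrite mul0r oppr0 expR0 mulr1; exact: le_trans.
pose m n := Num.truncn (expR (n%:R * tau)).
pose fn n t := f t * (1 - q n t) ^+ m n.
pose g t := f t * (tau < t)%R%:R.
have mn n : measurable_fun setT (fun t : R => (1 - q n t) ^+ m n).
  apply: measurable_funX; apply: measurable_funB => //; exact: measurable_expRM.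
have n1 n t : 0 <= t -> `|(1 - q n t) ^+ m n| <= 1.
  by move=> t0; have := @kernel_le1 n 0%N (m n) t t0; rewrite expr0 mul1r.
have mg : measurable_fun setT (fun t : R => (tau < t)%R%:R : R).
  have -> : (fun t : R => (tau < t)%R%:R : R) = \1_(`]tau, +oo[).
    by apply/funext => t; rewrite indicE mem_setE in_itv/= andbT.
  exact: measurable_indic.
have fni n : mu.-integrable setT (EFin \o fn n).
  by apply: integrableM_unit => //; exact: n1.
have gi : mu.-integrable setT (EFin \o g).
  apply: integrableM_unit => // t _; rewrite ger0_norm ?ler0n//.
  by rewrite lern1 leq_b1.
have cvgE : (\int[mu]_t fn n t)%:E @[n --> \oo] --> (\int[mu]_t g t)%:E.
  have EE (h : R -> R) : mu.-integrable setT (EFin \o h) ->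
      (\int[mu]_t h t)%:E = (\int[mu]_t (h t)%:E)%E.
    by move=> hi; rewrite fineK//; exact: integrable_fin_num hi.
  rewrite (EE g gi) (_ : (fun n => _) = fun n => (\int[mu]_t (fn n t)%:E)%E);
    last by apply/funext => n; exact: EE.
  have [|||||_ _] := @dominated_convergence _ _ _ mu setT measurableT
      (fun n => EFin \o fn n) (EFin \o g) (EFin \o (fun t => `|f t|)).
  - by move=> n; exact: measurable_int (fni n).
  - exact: measurable_int gi.
  (* At [t = tau] the kernel bound is the constant 1 and says nothing about convergence. At any
     other [t >= 0] it decays geometrically with ratio [exp (- |t - tau|)], and [f] vanishes at
     negative [t]. *)
  - exists [set tau]; split => //=; first exact: lebesgue_measure_set1.
    move=> t /= /not_implyP[_]; apply: contra_notP => /eqP ttau.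
    apply: cvg_EFin; first by near=> n.
    rewrite /comp/=; have [/f0 ft0|t0] := ltP t 0.
      rewrite /fn /g ft0 mul0r (_ : (fun _ => _) = cst 0).
        exact: cvg_cst.
      by apply/funext => n /=; rewrite mul0r.
    apply: (@cvg_geometric_bound _ _ `|f t| (expR (- `|t - tau|))).
      rewrite ger0_norm ?expR_ge0// expR_lt1 oppr_lt0 normr_gt0 subr_eq0.
      exact: ttau.
    move=> n; rewrite /fn /g -mulrBr normrM ler_wpM2l//.
    by rewrite -expRM_natl mulrN; exact: kernel_bound.
  - exact: integrable_norm.
  - apply: aeW => t n _ /=; rewrite lee_fin /fn normrM.
    have [/f0 ->|/n1 h] := ltP t 0; first by rewrite normr0 mul0r.
    by rewrite ler_piMr.
  by [].
have cvgg : \int[mu]_t fn n t @[n --> \oo] --> \int[mu]_t g t.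
  by have /fine_cvgP[] := cvgE.
have cvgf : \int[mu]_t fn n t @[n --> \oo] --> \int[mu]_t f t.
  apply: (@cvg_geometric_bound _ _ (K * expR 1) (expR (- (T - tau)))).
    by rewrite ger0_norm ?expR_ge0// expR_lt1 oppr_lt0 subr_gt0.
  move=> n; have := moment_kernel_bound f K T n (m n) fi f0 Kf.
  move=> /le_trans; apply; rewrite -mulrA ler_wpM2l//.
  rewrite -expRM_natl; set r := expR (- (n%:R * T)); set x := expR (n%:R * _).
  have r0 : 0 <= r by exact: expR_ge0.
  have x0 : 0 <= x by exact: expR_ge0.
  have x1 : x <= 1.
    rewrite -expR0 ler_expR mulrN oppr_le0 mulr_ge0// subr_ge0; exact: ltW.
  (* Here [x = exp (- n (T - tau))]. The choice of [m n] gives [m r <= x], so [(1 + r) ^ m - 1 <=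
     exp x - 1 <= x exp x <= x exp 1], which is geometric as [tau < T]. *)
  have mr : (m n)%:R * r <= x.
    have -> : x = expR (n%:R * tau) * r by rewrite -expRD; congr expR; ring.
    by rewrite ler_wpM2r// truncn_le expR_ge0.
  have h1 : (1 + r) ^+ m n <= expR x.
    apply: (@le_trans _ _ (expR r ^+ m n)); last by rewrite -expRM_natl ler_expR.
    by apply: lerXn2r; rewrite ?nnegrE ?expR_ge0 ?addr_ge0// expR_ge1Dx.
  have h2 : expR x - 1 <= x * expR x.
    have := ler_wpM2r (expR_ge0 x) (expR_ge1Dx (- x)).
    by rewrite -expRD addNr expR0; lra.
  have h3 : x * expR x <= x * expR 1 by rewrite ler_wpM2l// ler_expR.
  lra.
have fg : \int[mu]_t g t = \int[mu]_t f t.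
  exact: (cvg_unique _ cvgg cvgf).
rewrite Rintegral_mkcond.
transitivity (\int[mu]_t (f t - g t)).
  apply: eq_Rintegral => t _; rewrite /g patchE mem_setE in_itv/=.
  by case: leP => _; rewrite ?mulr1n ?mulr0n ?mulr1 ?mulr0 ?subr0 ?subrr.
by rewrite RintegralB// fg subrr.
Unshelve. all: by end_near. Qed.

(** The primitive of [f] from minus infinity vanishes identically on []-oo, T[], and by Lebesgue
    differentiation its derivative is [f] almost everywhere. *)
Lemma moment_decay_ae0 (f : R -> R) (K T : R) :
  mu.-integrable setT (EFin \o f) -> (forall t, t < 0 -> f t = 0) ->
  (forall n : nat, `|moment f n%:R| <= K * expR (- (n%:R * T))) ->
  \forall t \ae mu, t < T -> f t = 0.
Proof.
move=> fi f0 Kf.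
have fiy (y : R) : mu.-integrable `]-oo, y] (EFin \o f).
  exact: integrableS fi.
have fl : locally_integrable setT f.
  by have := integrable_locally measurableT fi; rewrite patch_setT.
have := FTC1Ny fiy fl.
apply: filterS; first exact: (ae_filter_ringOfSetsType mu).
move=> t [_ dft] tT.
rewrite -dft derive1E -[RHS](derive_cst (0 : R) t (1 : R)).
apply: near_eq_derive.
near=> s; apply: (@moment_tail_eq f K T) => //.
by near: s; exact: lt_nbhsl.
Unshelve. all: by end_near. Qed.

End phragmen.

(** * Densities on the unit interval are determined, up to a factor, by truncated
    autoconvolutions *)

Section unit_density.
Context {R : realType}.
Local Notation mu := (@lebesgue_measure R).
Local Open Scope ereal_scope.

Definition unit_density (a : R -> R) : Prop :=
  [/\ mu.-integrable setT (EFin \o a), (forall t, 0 <= a t)%R,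
      (forall t, t < 0 -> a t = 0)%R & (forall t, 1 < t -> a t = 0)%R].

(** For non-negative [a] this says that 0 lies in the essential support; positive mass is the form
    used in the lower bound on the transform. *)
Definition origin_in_supp1 (a : R -> R) : Prop :=
  forall e : R, (0 < e)%R -> 0 < \int[mu]_(t in `[0%R, e]) (a t)%:E.

(** The transform of the part of the autoconvolution visible in the limited data. *)
Definition laplace_conv_unit (a : R -> R) (p : R) : \bar R :=
  \int[mu]_(s in `[0%R, 1%R]) ((expR (- (p * s)))%:E * conv a s).

Lemma unit_density_measurable a : unit_density a -> measurable_fun setT a.
Proof. by case=> ai _ _ _; apply/measurable_EFinP; exact: measurable_int ai. Qed.

Lemma measurable_expRM_conv (a : R -> R) p : measurable_fun setT a ->
  (forall t, 0 <= a t)%R ->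
  measurable_fun setT (fun s : R => (expR (- (p * s)))%:E * conv a s).
Proof.
move=> ma a0; apply: emeasurable_funM; last exact: measurable_conv.
by apply/measurable_EFinP; exact: measurable_expRM.
Qed.

Lemma expRM_conv_ge0 (a : R -> R) p s : (forall t, 0 <= a t)%R ->
  0 <= (expR (- (p * s)))%:E * conv a s.
Proof. by move=> a0; rewrite mule_ge0 ?conv_ge0// lee_fin expR_ge0. Qed.

Lemma unit_density_moment_integrable a p : unit_density a -> (0 <= p)%R ->
  mu.-integrable setT (EFin \o (fun t => a t * expR (- (p * t))))%R.
Proof.
move=> [ai a0 an _] p0; apply: integrableM_unit => //.
  exact: measurable_expRM.
move=> t t0; rewrite ger0_norm ?expR_ge0//.
by rewrite -expR0 ler_expR oppr_le0 mulr_ge0.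
Qed.

Lemma laplace_moment a p : unit_density a -> (0 <= p)%R ->
  laplace a p = (moment a p)%:E.
Proof.
move=> ad p0; rewrite /moment /Rintegral fineK//.
apply: integrable_fin_num => //; exact: unit_density_moment_integrable.
Qed.

Lemma conv_lt0 a s : unit_density a -> (s < 0)%R -> conv a s = 0.
Proof.
move=> [_ _ an _] s0; rewrite /conv integral0_eq// => t _.
have [t0|t0] := ltP t 0%R; first by rewrite (an t)// mulr0.
by rewrite an ?mul0r//; lra.
Qed.

Lemma laplace_conv_unit_le a p : unit_density a -> (0 <= p)%R ->
  laplace_conv_unit a p <= (moment a p * moment a p)%:E.
Proof.
move=> ad p0; have [_ a0 _ _] := ad.
have ma := unit_density_measurable _ ad.
rewrite EFinM -!laplace_moment// -laplace_conv//.
apply: ge0_subset_integral => //.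
  exact: measurable_expRM_conv.
by move=> s _; exact: expRM_conv_ge0.
Qed.

(** The truncation error comes from [s > 1] only, where the weight is at most [exp (- p)]; the total
    mass of the autoconvolution is the square of the mass of [a], by the convolution theorem at
    0. *)
Lemma laplace_conv_unit_ge a p : unit_density a -> (0 <= p)%R ->
  (moment a p * moment a p)%:E <=
  laplace_conv_unit a p + (expR (- p) * (moment a 0 * moment a 0))%:E.
Proof.
move=> ad p0; have [_ a0 _ _] := ad.
have ma := unit_density_measurable _ ad.
have mE q : measurable_fun setT (fun s : R => (expR (- (q * s)))%:E * conv a s).
  exact: measurable_expRM_conv.
rewrite EFinM -!laplace_moment// -laplace_conv//.
rewrite -(setUv `[0%R, 1%R]) ge0_integral_setU//=; first last.
- by apply/disj_setPCl.
- by move=> s _; exact: expRM_conv_ge0.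
- by apply: measurable_funTS; exact: mE.
- exact: measurableC.
apply: leeD => //.
rewrite EFinM EFinM -!laplace_moment// -laplace_conv//.
rewrite -ge0_integralZl//=; last 2 first.
- exact: mE.
- by move=> s _; exact: expRM_conv_ge0.
apply: (@le_trans _ _ (\int[mu]_(s in ~` `[0%R, 1%R])
   ((expR (- p))%:E * ((expR (- (0 * s)))%:E * conv a s)))); last first.
  apply: ge0_subset_integral => //; first exact: measurableC.
    by apply: measurable_funTS; apply: emeasurable_funM => //; exact: mE.
  by move=> s _; rewrite mule_ge0 ?expRM_conv_ge0// lee_fin expR_ge0.
apply: ge0_le_integral => //.
- exact: measurableC.
- by move=> s _; exact: expRM_conv_ge0.
- by apply: measurable_funTS; exact: mE.
- by apply: measurable_funTS; apply: emeasurable_funM => //; exact: mE.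
move=> s /= /negP; rewrite in_itv/= negb_and -!ltNge => /orP[s0|s1].
  by rewrite conv_lt0// !mule0.
rewrite mul0r oppr0 expR0 mul1e lee_wpmul2r ?conv_ge0//.
by rewrite lee_fin ler_expR lerN2 ler_peMr// ltW.
Qed.

Lemma laplace_conv_unit_fin_num a p : unit_density a -> (0 <= p)%R ->
  laplace_conv_unit a p \is a fin_num.
Proof.
move=> ad p0; rewrite ge0_fin_numE.
  by rewrite (le_lt_trans (laplace_conv_unit_le _ _ ad p0))// ltry.
by apply: integral_ge0 => s _; apply: expRM_conv_ge0; case: ad.
Qed.

(** Mass near the origin keeps the transform from decaying at a fixed exponential rate: on [0, e]
    the weight is at least [exp (- p e)]. *)
Lemma moment_lower_bound a p e : unit_density a -> (0 <= p)%R -> (0 < e)%R ->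
  (expR (- (p * e)))%:E * \int[mu]_(t in `[0%R, e]) (a t)%:E <= laplace a p.
Proof.
move=> ad p0 e0; have [_ a0 _ _] := ad.
have ma := unit_density_measurable _ ad.
rewrite -ge0_integralZl//=; first last.
- by move=> t _; rewrite lee_fin.
- by apply: measurable_funTS; exact/measurable_EFinP.
apply: (@le_trans _ _ (\int[mu]_(t in `[0%R, e])
    (a t * expR (- (p * t)))%:E)).
  apply: ge0_le_integral => //.
  - by move=> t _; rewrite lee_fin mulr_ge0 ?expR_ge0.
  - apply: emeasurable_funM => //.
    by apply: measurable_funTS; exact/measurable_EFinP.
  - apply: measurable_funTS; apply/measurable_EFinP.
    by apply: measurable_funM => //; exact: measurable_expRM.
  move=> t; rewrite /= in_itv/= => /andP[t0 te].
  rewrite -EFinM lee_fin mulrC ler_wpM2l// ler_expR lerN2 ler_wpM2l//.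
apply: ge0_subset_integral => //.
- apply/measurable_EFinP.
  by apply: measurable_funM => //; exact: measurable_expRM.
- by move=> t _; rewrite lee_fin mulr_ge0 ?expR_ge0.
Qed.

(** This supplies the strict positivity that makes the separation constants well defined and
    positive. *)
Lemma laplace_conv_unit_gt0 a p : unit_density a -> origin_in_supp1 a ->
  (0 <= p)%R -> 0 < laplace_conv_unit a p.
Proof.
move=> ad as0 p0; have [ai a0 an _] := ad.
have ma := unit_density_measurable _ ad.
(* The autoconvolution of the restriction of [a] to [0, 1/2] lives in [0, 1]. *)
pose h : R := 2^-1%R; have h0 : (0 < h)%R by rewrite invr_gt0.
pose b t := (a t * \1_(`[0%R, h]) t)%R.
have bh t : (h < t)%R -> b t = 0%R.
  move=> ht; rewrite /b indicE memNset ?mulr0//= in_itv/=; lra.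
have ba t : (b t <= a t)%R.
  by rewrite /b ler_piMr// indicE lern1 leq_b1.
have b0 t : (0 <= b t)%R by rewrite mulr_ge0.
have mb : measurable_fun setT b by apply: measurable_funM.
have bd : unit_density b.
  split => //.
  - apply: (le_integrable measurableT _ _ ai); first exact/measurable_EFinP.
    by move=> t _ /=; rewrite lee_fin !ger0_norm.
  - by move=> t t0; rewrite /b an// mul0r.
  - by move=> t t1; apply: bh; rewrite /h; lra.
have bL : 0 < laplace b p.
  apply: lt_le_trans (moment_lower_bound _ _ _ bd p0 h0).
  apply: mule_gt0; first by rewrite lte_fin expR_gt0.
  rewrite (_ : \int[mu]_(t in _) _ = \int[mu]_(t in `[0%R, h]) (a t)%:E).
    exact: as0.
  apply: eq_integral; by move=> t th /=; rewrite /b indicE th mulr1.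
apply: (@lt_le_trans _ _ (laplace b p * laplace b p)); first exact: mule_gt0.
rewrite -laplace_conv// (_ : \int[mu]_s _ = laplace_conv_unit b p); last first.
  rewrite /laplace_conv_unit [RHS]integral_mkcond; apply: eq_integral => s _.
  rewrite patchE mem_setE in_itv/=; case: ifPn => //.
  rewrite negb_and -!ltNge => /orP[s0|s1]; first by rewrite conv_lt0// mule0.
  rewrite [conv _ _]integral0_eq ?mule0// => t _.
  have [th|th] := ltP h t; first by rewrite (bh t)// mulr0.
  by rewrite (bh (s - t)%R) ?mul0r//; move: th s1; rewrite /h; lra.
apply: ge0_le_integral => //.
- by move=> s _; exact: expRM_conv_ge0.
- by apply: measurable_funTS; exact: measurable_expRM_conv.
- by apply: measurable_funTS; exact: measurable_expRM_conv.
move=> s _; apply: lee_wpmul2l; first by rewrite lee_fin expR_ge0.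
apply: ge0_le_integral => //.
- by move=> t _; rewrite lee_fin mulr_ge0.
- by apply/measurable_EFinP; exact: measurable_conv_section.
- by apply/measurable_EFinP; exact: measurable_conv_section.
- by move=> t _; rewrite lee_fin ler_pM.
Qed.

Lemma unit_density_scaling a d (c : R) : unit_density a -> unit_density d ->
  origin_in_supp1 d -> (0 < c)%R ->
  (forall n : nat, laplace_conv_unit a n%:R = c%:E * laplace_conv_unit d n%:R) ->
  \forall t \ae mu, (t < 1)%R -> a t = (Num.sqrt c * d t)%R.
Proof.
move=> ad dd d0 c0 acd.
have [ai age0 an _] := ad; have [di dge0 dn _] := dd.
pose f t := (a t - Num.sqrt c * d t)%R.
have fi : mu.-integrable setT (EFin \o f).
  have := integrableB measurableT ai (integrableZl measurableT (Num.sqrt c) di).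
  by apply: eq_integrable => // t _ /=; rewrite /f EFinB EFinM.
have fn t : (t < 0)%R -> f t = 0%R by move=> t0; rewrite /f an// dn// mulr0 subr0.
have sc0 : (0 < Num.sqrt c)%R by rewrite sqrtr_gt0.
have fT (e : R) : (0 < e)%R ->
  exists K, forall n : nat, (`|moment f n%:R| <= K * expR (- (n%:R * (1 - e))))%R.
  move=> e0; pose eta := fine (\int[mu]_(t in `[0%R, e]) (d t)%:E).
  have ifin : \int[mu]_(t in `[0%R, e]) (d t)%:E \is a fin_num.
    apply: integrable_fin_num => //; exact: integrableS di.
  have eta0 : (0 < eta)%R by apply: fine_gt0; rewrite d0//= ltey_eq ifin.
  pose C := (moment a 0 ^+ 2 + c * moment d 0 ^+ 2)%R.
  (* [C] collects the truncation errors of both densities, and [sqrt c * eta] comes from the lower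
     bound on the factor [X + sqrt c Y], [eta] being the mass of [d] on [0, e]. *)
  exists (C / (Num.sqrt c * eta))%R => n.
  have n0 : (0 <= n%:R :> R)%R by [].
  set X := moment a n%:R; set Y := moment d n%:R.
  have -> : moment f n%:R = (X - Num.sqrt c * Y)%R.
    rewrite /X /Y /moment -RintegralZl//; last first.
      exact: unit_density_moment_integrable.
    rewrite -RintegralB//; first last.
    - have := integrableZl measurableT (Num.sqrt c)
        (unit_density_moment_integrable _ _ dd n0).
      by apply: eq_integrable => // t _ /=; rewrite EFinM.
    - exact: unit_density_moment_integrable.
    by apply: eq_Rintegral => t _; rewrite /f; ring.
  have X0 : (0 <= X)%R.
    by rewrite -lee_fin -laplace_moment// laplace_ge0.
  have Yge : (expR (- (n%:R * e)) * eta <= Y)%R.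
    rewrite -lee_fin -laplace_moment// EFinM fineK//.
    exact: moment_lower_bound.
  have := laplace_conv_unit_le _ _ ad n0.
  have := laplace_conv_unit_ge _ _ ad n0.
  have := laplace_conv_unit_le _ _ dd n0.
  have := laplace_conv_unit_ge _ _ dd n0.
  rewrite acd -/X -/Y.
  have := laplace_conv_unit_fin_num _ _ dd n0.
  case: (laplace_conv_unit d n%:R) => // B _.
  rewrite -EFinM -!EFinD !lee_fin => h1 h2 h3 h4.
  set E := expR (- n%:R)%R in h1 h3.
  have E0 : (0 <= E)%R by exact: expR_ge0.
  have c2 : c = (Num.sqrt c * Num.sqrt c)%R by rewrite -expr2 sqr_sqrtr// ltW.
  (* Both [X ^ 2] and [c Y ^ 2] lie above the common value [c B] by at most their own truncation
     error, of order [E = exp (- n)]. *)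
  have XY : (`|X ^+ 2 - c * Y ^+ 2| <= E * C)%R.
    have := ler_wpM2l (ltW c0) h1; have := ler_wpM2l (ltW c0) h2.
    have : (0 <= E * moment a 0 ^+ 2)%R by rewrite mulr_ge0 ?sqr_ge0.
    have : (0 <= E * (c * moment d 0 ^+ 2))%R.
      by rewrite mulr_ge0// mulr_ge0 ?sqr_ge0// ltW.
    rewrite /C ler_norml !expr2 !mulrDr => ? ? ? ?; apply/andP; split; lra.
  (* Factor the difference of squares. As [X >= 0], nothing cancels in [X + sqrt c Y], which is thus
     at least [sqrt c Y]. *)
  have XYf : (`|X - Num.sqrt c * Y| * (Num.sqrt c * (expR (- (n%:R * e)) * eta))
      <= E * C)%R.
    apply: le_trans XY.
    have -> : (X ^+ 2 - c * Y ^+ 2 =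
      (X - Num.sqrt c * Y) * (X + Num.sqrt c * Y))%R by rewrite {1}c2; ring.
    rewrite normrM ler_wpM2l// ger0_norm.
      by rewrite (le_trans (ler_wpM2l (ltW sc0) Yge))// lerDr.
    by rewrite addr_ge0// mulr_ge0 ?ltW// (lt_le_trans _ Yge)// mulr_gt0 ?expR_gt0.
  have -> : (- (n%:R * (1 - e)) = - n%:R + n%:R * e)%R by ring.
  rewrite expRD -/E mulrAC ler_pdivlMr; last exact: mulr_gt0.
  have Ee : (expR (- (n%:R * e)) * expR (n%:R * e) = 1)%R.
    by rewrite -expRD addNr expR0.
  have := ler_wpM2r (expR_ge0 (n%:R * e)%R) XYf.
  have assoc (u v w x z : R) : (u * (v * (w * x)) * z = u * (v * x) * (w * z))%R.
    by ring.
  by rewrite assoc Ee mulr1 => /le_trans; apply; rewrite (mulrC E) mulrA.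
(* Letting [e] run through the countable family [1 / (k + 1)] keeps the union of the exceptional
   sets null; these intervals exhaust [t < 1]. *)
have faek : \forall t \ae mu, forall k : nat, (t < 1 - k.+1%:R^-1)%R -> f t = 0%R.
  apply: ae_foralln => k.
  have [|K HK] := fT k.+1%:R^-1%R; first by rewrite invr_gt0.
  exact: moment_decay_ae0 HK.
move: faek; apply: filterS; first exact: (ae_filter_ringOfSetsType mu).
move=> t ft t1; apply/eqP; rewrite -subr_eq0; apply/eqP.
have t1' : (0 < 1 - t)%R by rewrite subr_gt0.
have [k _ /(_ k (leqnn k)) /= kt] := near_infty_natSinv_lt (PosNum t1').
by apply: (ft k); rewrite ltrBrDl -ltrBrDr.
Qed.

End unit_density.

(** * Autoconvolution of an almost everywhere factored function *)

Section separation.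
Context {R : realType}.
Local Notation mu := (@lebesgue_measure R).
Local Notation mu2 := (leb2 R).
Local Notation T := (measurableTypeR R).
Local Open Scope ereal_scope.

(** By Tonelli the measures of the sections integrate to the measure of [N], and a non-negative
    function with zero integral vanishes almost everywhere. *)
Lemma ae_ysection_null (N : set (T * T)) : measurable N -> mu2 N = 0 ->
  \forall y \ae mu, mu (ysection N y) = 0.
Proof.
move=> mN N0.
have m1 : measurable_fun setT (fun z : T * T => (\1_N z)%:E : \bar R).
  exact/measurable_EFinP.
have mY : measurable_fun setT (fun y : T => mu (ysection N y)).
  exact: measurable_fun_ysection.
have : \int[mu]_y `|mu (ysection N y)| = 0.
  rewrite -[RHS]N0 -[in RHS](setIT N) -[RHS]integral_indic//.
  rewrite (fubini_tonelli2 _ m1)//.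
  apply: eq_integral => y _; rewrite gee0_abs//.
  transitivity (\int[mu]_x (\1_(ysection N y) x)%:E).
    by rewrite integral_indic ?setIT//; exact: measurable_ysection.
  by apply: eq_integral => x _; rewrite !indicE mem_ysection.
move=> /(ae_eq_integral_abs mu measurableT mY)[M [mM M0 PM]].
exists M; split => // y /= Py; apply: PM => /= H; apply: Py; exact: H.
Qed.

Lemma ae_reflect (c : R) (P : set R) : (\forall t \ae mu, P t) ->
  \forall t \ae mu, P (c - t)%R.
Proof.
move=> [N [mN N0 PN]]; exists ((fun t => c - t)%R @^-1` N); split.
- by have := measurable_reflect c measurableT N mN; rewrite setTI.
- by rewrite -N0; exact: lebesgue_measure_reflect.
- by move=> t /= Pt; exact: PN.
Qed.

(** The case of an infinite integral is included, since [fine] sends both sides to 0. This matters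
    because a convolution may be infinite at individual points. *)
Lemma ge0_RintegralZl (D : set R) (k : R) (f : R -> R) : measurable D ->
  measurable_fun D f -> (forall t, D t -> 0 <= f t)%R -> (0 <= k)%R ->
  (\int[mu]_(t in D) (k * f t) = k * \int[mu]_(t in D) f t)%R.
Proof.
move=> mD mf f0 k0; rewrite /Rintegral.
under eq_integral do rewrite EFinM.
rewrite ge0_integralZl//; last exact/measurable_EFinP.
have : 0 <= \int[mu]_(t in D) (f t)%:E by apply: integral_ge0.
case: (\int[mu]_(t in D) (f t)%:E) => [r|_|]//.
move: k0; rewrite le_eqVlt => /predU1P[<-|k0]; first by rewrite mul0e/= mul0r.
by rewrite gt0_muley ?lte_fin//= mulr0.
Qed.

Lemma Rintegral_conv (a : R -> R) s : unit_density a ->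
  (\int[mu]_(t in `[0, s]) (a (s - t) * a t) = fine (conv a s))%R.
Proof.
move=> [_ _ an _]; rewrite Rintegral_mkcond; congr fine.
apply: eq_integral => t _; rewrite patchE mem_setE in_itv/=.
case: ifPn => //; rewrite negb_and -!ltNge => /orP[t0|st].
  by rewrite (an t)// mulr0.
by rewrite an ?mul0r// subr_lt0.
Qed.

(** As [h] may change sign, Tonelli's measurability is applied to the positive and negative parts
    separately. *)
Lemma measurable_Rintegral_section (D : set R) (h : T * T -> R) :
  measurable D -> measurable_fun setT h ->
  measurable_fun setT (fun y : T => \int[mu]_(x in D) h (x, y))%R.
Proof.
move=> mD mh.
pose k (z : T * T) := (h z * \1_D z.1)%:E.
have mk : measurable_fun setT k.
  apply/measurable_EFinP; apply: measurable_funM => //.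
  apply: (@measurableT_comp _ _ _ _ _ _ (\1_D : T -> R)).
    exact: measurable_indic.
  exact: measurable_fst.
apply: (@measurableT_comp _ _ _ _ _ _ (fine : \bar R -> R)).
  exact: fine_measurable.
rewrite (_ : (fun _ => _) = fun y =>
  \int[mu]_x k^\+ (x, y) - \int[mu]_x k^\- (x, y)).
  apply: emeasurable_funB.
    by apply: measurable_fun_fubini_tonelli_G => //; exact: measurable_funepos.
  by apply: measurable_fun_fubini_tonelli_G => //; exact: measurable_funeneg.
apply/funext => y; rewrite integral_mkcond [LHS]integralE.
congr (_ - _); apply: eq_integral => x _;
  by rewrite ?funeposE ?funenegE patchE /k indicE/=; case: ifPn => _;
    rewrite ?mulr1 ?mulr0.
Qed.

(** The factorisation may fail on a null set [N]. For almost every [t2] the sections of [N] at [t2]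
    and at [s.2 - t2] are both null, so the inner integrand is a product for almost every [t1]. The
    formula thus holds at every [s] of the square. *)
Lemma autoconv_factor (x : R * R -> R) (a1 a2 : R -> R) (s : R * R) :
  measurable_fun (setT : set (T * T)) (x : T * T -> R) ->
  unit_density a1 -> unit_density a2 ->
  x = (fun t => a1 t.1 * a2 t.2)%R %[ae mu2 in @unit_square R] ->
  @unit_square R s ->
  autoconv x s = (fine (conv a1 s.1) * fine (conv a2 s.2))%R.
Proof.
move=> mx ad1 ad2 [N [mN N0 xN]] [/= s1 s2].
have ma1 := unit_density_measurable _ ad1.
have ma2 := unit_density_measurable _ ad2.
have [_ a10 _ _] := ad1; have [_ a20 _ _] := ad2.
move: s1 s2; rewrite /= !in_itv/= => /andP[s10 s11] /andP[s20 s21].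
have xE t1 t2 : (0 <= t1 <= 1)%R -> (0 <= t2 <= 1)%R -> ~ N (t1, t2) ->
    x (t1, t2) = (a1 t1 * a2 t2)%R.
  move=> t1P t2P /(subsetC xN)/= /contrapT; apply.
  by split; rewrite /= in_itv.
pose h (t : T * T) := (x (s.1 - t.1, s.2 - t.2) * x t)%R.
have mh : measurable_fun setT h.
  apply: measurable_funM => //; apply: (@measurableT_comp _ _ _ _ _ _ x) => //.
  apply/measurable_fun_pairP; split.
    by apply: measurable_funB => //; exact: measurable_fst.
  by apply: measurable_funB => //; exact: measurable_snd.
have ysN := ae_ysection_null _ mN N0.
have inner : \forall t2 \ae mu, t2 \in `[0%R, s.2] ->
    (\int[mu]_(t1 in `[0%R, s.1]) h (t1, t2) =
    fine (conv a1 s.1) * (a2 (s.2 - t2) * a2 t2))%R.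
  have := ae_reflect s.2 _ ysN; move: ysN.
  apply: (@filterS2 _ _ (ae_filter_ringOfSetsType mu)).
  move=> t2 N1 N2; rewrite in_itv/= => /andP[t20 t2s].
  transitivity (\int[mu]_(t1 in `[0%R, s.1])
      ((a2 (s.2 - t2) * a2 t2) * (a1 (s.1 - t1) * a1 t1)))%R.
    rewrite /Rintegral; congr fine; apply: ae_eq_integral => //.
    - apply: measurable_funTS; apply/measurable_EFinP.
      exact: (@measurable_fun_pair1 _ _ _ _ _ _ h t2 mh).
    - apply: measurable_funTS; apply/measurable_EFinP.
      by apply: measurable_funM => //; exact: measurable_conv_section.
    have mY1 := measurable_ysection t2 mN.
    have mY2 := measurable_ysection (s.2 - t2)%R mN.
    have H1 : \forall t1 \ae mu, ~ ysection N t2 t1.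
      by exists (ysection N t2); split => // ? /=; rewrite notK.
    have H2 : \forall t1 \ae mu, ~ ysection N (s.2 - t2)%R t1.
      by exists (ysection N (s.2 - t2)%R); split => // ? /=; rewrite notK.
    have := ae_reflect s.1 _ H2; move: H1.
    apply: (@filterS2 _ _ (ae_filter_ringOfSetsType mu)).
    move=> t1; rewrite /ysection/= in_itv/= => + + /andP[t10 t1s]; rewrite !inE.
    move=> M1 M2; rewrite /h/= !xE//; [congr EFin; ring| | | |]; apply/andP; split; lra.
  rewrite ge0_RintegralZl//.
  - by rewrite (Rintegral_conv _ _ ad1) mulrC.
  - by apply: measurable_funTS; exact: measurable_conv_section.
  - by move=> t _; rewrite mulr_ge0.
  - by rewrite mulr_ge0.
transitivity (\int[mu]_(t2 in `[0%R, s.2])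
    (fine (conv a1 s.1) * (a2 (s.2 - t2) * a2 t2)))%R.
  rewrite /autoconv [LHS]/Rintegral [RHS]/Rintegral; congr fine.
  apply: ae_eq_integral => //.
  - apply: measurable_funTS; apply/measurable_EFinP.
    exact: (@measurable_Rintegral_section _ h).
  - apply: measurable_funTS; apply/measurable_EFinP.
    by apply: measurable_funM => //; exact: measurable_conv_section.
  move: inner; apply: filterS; first exact: (ae_filter_ringOfSetsType mu).
  by move=> t2 H t2s; rewrite -H.
rewrite ge0_RintegralZl//.
- by rewrite (Rintegral_conv _ _ ad2).
- by apply: measurable_funTS; exact: measurable_conv_section.
- by move=> t _; rewrite mulr_ge0.
- by apply: fine_ge0; exact: conv_ge0.
Qed.

End separation.

(** * Passage to densities, separation of variables and uniqueness *)

Section uniqueness.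
Context {R : realType}.
Local Notation mu := (@lebesgue_measure R).
Local Notation mu2 := (leb2 R).
Local Notation T := (measurableTypeR R).
Local Open Scope ereal_scope.

Lemma ae_fst (P : R -> Prop) : (\forall t \ae mu, P t) ->
  \forall z \ae mu2, P z.1.
Proof.
move=> [N [mN N0 PN]]; exists (N `*` setT); split.
- exact: measurableX.
- by rewrite product_measure1E// [X in X * _]N0 mul0e.
- by move=> z /= Pz; split => //; exact: PN.
Qed.

Lemma ae_snd (P : R -> Prop) : (\forall t \ae mu, P t) ->
  \forall z \ae mu2, P z.2.
Proof.
move=> [N [mN N0 PN]]; exists (setT `*` N); split.
- exact: measurableX.
- by rewrite product_measure1E// [X in _ * X]N0 mule0.
- by move=> z /= Pz; split => //; exact: PN.
Qed.

(** Take the positive part of [f] cut to [0, 1]. It is integrable, being dominated by [f ^ 2] plus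
    the indicator of [0, 1]. *)
Lemma unit_density_of_L2 (f : R -> R) : L2_interval f -> ae_nonneg f ->
  exists2 a, unit_density a &
    \forall t \ae mu, (0 <= t <= 1)%R -> f t = a t.
Proof.
move=> [fL _] f0.
have mf : measurable_fun setT f.
  by move: fL; rewrite inE => /andP[]; rewrite inE.
have f2 := Lfun2_integrable_sqr fL.
pose a t := (Num.max (f t) 0 * \1_(`[0%R, 1%R]) t)%R.
have a0 t : (0 <= a t)%R by rewrite mulr_ge0// le_max lexx orbT.
have ma : measurable_fun setT a.
  by apply: measurable_funM => //; exact: measurable_maxr.
have aout t : ~~ (0 <= t <= 1)%R -> a t = 0%R.
  by move=> t01; rewrite /a indicE memNset ?mulr0//= in_itv/=; exact/negP.
exists a; first split => //.
- have i1 : mu.-integrable setT (EFin \o (\1_(`[0%R, 1%R]) : R -> R)).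
    exact: integrable_indic_itv.
  apply: (le_integrable measurableT _ _ (integrableD measurableT f2 i1)).
    exact/measurable_EFinP.
  move=> t _ /=; rewrite lee_fin ger0_norm// ger0_norm.
    rewrite /a; set i := \1_ _ t.
    have : (i = 0 \/ i = 1)%R by rewrite /i indicE; case: (_ \in _); [right|left].
    have : (Num.max (f t) 0 <= f t ^+ 2 + 1)%R.
      by rewrite ge_max expr2; apply/andP; split; nra.
    have := sqr_ge0 (f t).
    by move=> ? ? [->|->]; lra.
  by rewrite addr_ge0 ?sqr_ge0.
- by move=> t t0; apply: aout; apply/negP => /andP[]; lra.
- by move=> t t1; apply: aout; apply/negP => /andP[]; lra.
move: f0; apply: filterS; first exact: (ae_filter_ringOfSetsType mu).
move=> t ft t01; have f0 : (0 <= f t)%R by apply: ft; rewrite /unit_interval/= in_itv.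
by rewrite /a indicE mem_set ?mulr1 ?max_l//= in_itv.
Qed.

(** Points of the disc of radius [e] have both coordinates below [e], so the set of positive measure
    given for this radius would be null. *)
Lemma origin_in_supp_not_ae0 (x : R * R -> R) (e : R) :
  (0 < e)%R -> origin_in_supp x ->
  ~ \forall t \ae mu2,
    @unit_square R t -> (t.1 <= e)%R -> (t.2 <= e)%R -> x t = 0%R.
Proof.
move=> e0 /(_ e e0)[M [mM Msub M0 xM]] xae.
have : \forall t \ae mu2, ~ M t.
  move: xM xae; apply: (@filterS2 _ _ (ae_filter_ringOfSetsType mu2)).
  move=> t xM xt Mt; have [dt st] := Msub t Mt.
  have := xM Mt; rewrite xt ?eqxx//.
    by move: dt; rewrite /disc0/=; have [/= /itvP s1 /itvP s2] := st;
      rewrite !expr2; nra.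
  by move: dt; rewrite /disc0/=; have [/= /itvP s1 /itvP s2] := st;
      rewrite !expr2; nra.
move=> [N [mN N0 MN]].
suff : mu2 M <= 0 by rewrite leNgt M0.
rewrite -N0; apply: le_measure; rewrite ?inE//.
by move=> t Mt; apply: MN => /=; apply.
Qed.

Lemma unit_density_supp (d : R -> R) (e : R) : unit_density d -> 
  ~ (0 < \int[mu]_(t in `[0%R, e]) (d t)%:E) ->
  \forall t \ae mu, (0 <= t)%R -> (t <= e)%R -> d t = 0%R.
Proof.
move=> dd; have [_ d0 _ _] := dd; have md := unit_density_measurable _ dd.
have i0 : 0 <= \int[mu]_(t in `[0%R, e]) (d t)%:E.
  by apply: integral_ge0 => t _; rewrite lee_fin.
move=> /negP; rewrite -leNgt => i0'.
have : \int[mu]_(t in `[0%R, e]) `|(d t)%:E| = 0.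
  apply/eqP; rewrite eq_le; apply/andP; split; last exact: integral_ge0.
  apply: le_trans i0'; rewrite le_eqVlt; apply/orP; left; apply/eqP.
  by apply: eq_integral => t _; rewrite gee0_abs// lee_fin.
have mde : measurable_fun (`[0%R, e] : set T) (EFin \o d).
  by apply: measurable_funTS; exact/measurable_EFinP.
have mI : measurable (`[0%R, e]%classic : set T) by exact: measurable_itv.
move=> /(ae_eq_integral_abs mu mI mde)[M [mM M0 PM]].
exists M; split => // t /= Pt; apply: PM => /= H; apply: Pt => t0 te.
have : t \in `[0%R, e] by rewrite in_itv/= t0 te.
by move=> /H [].
Qed.

(** If [d1] had no mass on [0, e], the product would vanish almost everywhere on the strip
    [t.1 <= e] of the square. *)
Lemma origin_in_supp_fst (x : R * R -> R) (d1 d2 : R -> R) :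
  unit_density d1 -> origin_in_supp x ->
  x = (fun t => d1 t.1 * d2 t.2)%R %[ae mu2 in @unit_square R] ->
  origin_in_supp1 d1.
Proof.
move=> dd1 xs xE e e0; apply: contrapT => /(unit_density_supp _ _ dd1)/ae_fst H.
apply: (origin_in_supp_not_ae0 _ _ e0 xs).
move: H xE; apply: (@filterS2 _ _ (ae_filter_ringOfSetsType mu2)).
move=> t H1 H2 st te _; rewrite H2// H1 ?mul0r//.
by have [/= /itvP s1 _] := st; rewrite s1.
Qed.

Lemma origin_in_supp_snd (x : R * R -> R) (d1 d2 : R -> R) :
  unit_density d2 -> origin_in_supp x ->
  x = (fun t => d1 t.1 * d2 t.2)%R %[ae mu2 in @unit_square R] ->
  origin_in_supp1 d2.
Proof.
move=> dd2 xs xE e e0; apply: contrapT => /(unit_density_supp _ _ dd2)/ae_snd H.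
apply: (origin_in_supp_not_ae0 _ _ e0 xs).
move: H xE; apply: (@filterS2 _ _ (ae_filter_ringOfSetsType mu2)).
move=> t H1 H2 st _ te; rewrite H2// H1 ?mulr0//.
by have [/= _ /itvP s1] := st; rewrite s1.
Qed.

(** The integrand of [laplace_conv_unit], extended by zero and made real with [fine], because the
    equation on the square compares [fine] values. *)
Let g (a : R -> R) (p s : R) : R :=
  (expR (- (p * s)) * fine (conv a s) * \1_(`[0%R, 1%R]) s)%R.

Let measurable_g a p : unit_density a -> measurable_fun setT (g a p : T -> R).
Proof.
move=> ad; have [_ a0 _ _] := ad; have ma := unit_density_measurable _ ad.
apply: measurable_funM => //; apply: measurable_funM.
  exact: measurable_expRM.
apply: (@measurableT_comp _ _ _ _ _ _ (fine : \bar R -> R)).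
  exact: fine_measurable.
exact: measurable_conv.
Qed.

Let g_ge0 a p s : unit_density a -> (0 <= g a p s)%R.
Proof.
move=> [_ a0 _ _]; rewrite mulr_ge0// mulr_ge0 ?expR_ge0//.
by apply: fine_ge0; exact: conv_ge0.
Qed.

(** Passing to [fine] loses nothing: at [p = 0] the weight is 1, so integrability there makes
    [conv a] finite almost everywhere on [0, 1]. *)
Let integral_g a p : unit_density a ->
  \int[mu]_s (g a p s)%:E = laplace_conv_unit a p.
Proof.
move=> ad; have [_ a0 _ _] := ad; have ma := unit_density_measurable _ ad.
have mE q : measurable_fun setT (fun s : R => (expR (- (q * s)))%:E * conv a s).
  exact: measurable_expRM_conv.
have ci : mu.-integrable `[0%R, 1%R] (fun s : R => (expR (- (0 * s)))%:E * conv a s).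
  apply/integrableP; split; first by apply: measurable_funTS; exact: mE.
  have := laplace_conv_unit_fin_num _ _ ad (lexx 0%R).
  rewrite ge0_fin_numE; last by apply: integral_ge0 => s _; exact: expRM_conv_ge0.
  apply: le_lt_trans; rewrite le_eqVlt; apply/orP; left; apply/eqP.
  by apply: eq_integral => s _; rewrite gee0_abs// expRM_conv_ge0.
rewrite /laplace_conv_unit [RHS]integral_mkcond; apply: ge0_ae_eq_integral => //.
- by apply/measurable_EFinP; exact: measurable_g.
- have mI : measurable (`[0%R, 1%R]%classic : set T) by exact: measurable_itv.
  by apply: (measurable_restrictT _ mI).1; apply: measurable_funTS; exact: mE.
- by move=> s _; rewrite lee_fin g_ge0.
- by move=> s _; rewrite patchE; case: ifPn => // _; exact: expRM_conv_ge0.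
have := integrable_ae _ ci; move=> /(_ (measurable_itv _)).
move=> [N [mN N0 PN]]; exists N; split => // s /= Ps; apply: PN => /= H.
apply: Ps => _; rewrite patchE /g indicE; case: ifPn => [/set_mem s01|_].
  have := H s01; rewrite mul0r oppr0 expR0 mul1e => cfin.
  by rewrite mulr1 EFinM fineK.
by rewrite mulr0.
Qed.

Let integral_g2 a1 a2 p q : unit_density a1 -> unit_density a2 ->
  \int[mu2]_z (g a1 p z.1 * g a2 q z.2)%:E =
  laplace_conv_unit a1 p * laplace_conv_unit a2 q.
Proof.
move=> ad1 ad2.
have mg1 := measurable_g _ p ad1; have mg2 := measurable_g _ q ad2.
rewrite (fubini_tonelli1 (fun z : T * T => (g a1 p z.1 * g a2 q z.2)%:E)).
- rewrite -!integral_g// -ge0_integralZr//.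
  + apply: eq_integral => s _; rewrite /fubini_F/= -ge0_integralZl//.
    * exact/measurable_EFinP.
    * by move=> t _; rewrite lee_fin g_ge0.
    * by rewrite lee_fin g_ge0.
  + exact/measurable_EFinP.
  + by move=> t _; rewrite lee_fin g_ge0.
  + by apply: integral_ge0 => t _; rewrite lee_fin g_ge0.
- apply/measurable_EFinP; apply: measurable_funM.
    by apply: measurableT_comp => //; exact: measurable_fst.
  by apply: measurableT_comp => //; exact: measurable_snd.
- by move=> z; rewrite lee_fin mulr_ge0 ?g_ge0.
Qed.

(** Integrating the identity against exponentials separates the variables. Freezing one variable at
    0 puts each one-dimensional pair under the scaling lemma, and the two scaling factors multiply
    to 1. *)
Lemma tensor_autoconvolution_unique a1 a2 d1 d2 :
  unit_density a1 -> unit_density a2 -> unit_density d1 -> unit_density d2 ->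
  origin_in_supp1 d1 -> origin_in_supp1 d2 ->
  (fun s => fine (conv a1 s.1) * fine (conv a2 s.2))%R =
  (fun s => fine (conv d1 s.1) * fine (conv d2 s.2))%R
    %[ae mu2 in @unit_square R] ->
  (fun s => a1 s.1 * a2 s.2)%R = (fun s => d1 s.1 * d2 s.2)%R
    %[ae mu2 in @unit_square R].
Proof.
move=> ad1 ad2 dd1 dd2 ds1 ds2 cE.
have LE p q : laplace_conv_unit a1 p * laplace_conv_unit a2 q =
    laplace_conv_unit d1 p * laplace_conv_unit d2 q.
  rewrite -(integral_g2 _ _ p q ad1 ad2) -(integral_g2 _ _ p q dd1 dd2).
  apply: ge0_ae_eq_integral; first exact: measurableT.
  - apply/measurable_EFinP; apply: measurable_funM.
      apply: measurableT_comp; [exact: measurable_g|exact: measurable_fst].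
    apply: measurableT_comp; [exact: measurable_g|exact: measurable_snd].
  - apply/measurable_EFinP; apply: measurable_funM.
      apply: measurableT_comp; [exact: measurable_g|exact: measurable_fst].
    apply: measurableT_comp; [exact: measurable_g|exact: measurable_snd].
  - by move=> z _; rewrite lee_fin mulr_ge0 ?g_ge0.
  - by move=> z _; rewrite lee_fin mulr_ge0 ?g_ge0.
  move: cE; apply: filterS; first exact: (ae_filter_ringOfSetsType mu2).
  move=> s H _; congr EFin; rewrite /g !indicE.
  have [s1|] := boolP (s.1 \in `[0%R, 1%R]%classic); last by rewrite !mulr0 !mul0r.
  have [s2|] := boolP (s.2 \in `[0%R, 1%R]%classic); last by rewrite !mulr0.
  rewrite !mulr1 mulrACA [RHS]mulrACA; congr (_ * _)%R; apply: H.
  by split; exact/set_mem.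
have fn a (n : nat) : unit_density a -> exists r : R, laplace_conv_unit a n%:R = r%:E.
  move=> ad; have := laplace_conv_unit_fin_num a n%:R ad (ler0n _ _).
  by case: (laplace_conv_unit a _) => // r _; exists r.
have [A1 EA1] := fn a1 0%N ad1; have [A2 EA2] := fn a2 0%N ad2.
have [D1 ED1] := fn d1 0%N dd1; have [D2 ED2] := fn d2 0%N dd2.
have D1p : (0 < D1)%R.
  by have := laplace_conv_unit_gt0 _ _ dd1 ds1 (ler0n R 0); rewrite ED1 lte_fin.
have D2p : (0 < D2)%R.
  by have := laplace_conv_unit_gt0 _ _ dd2 ds2 (ler0n R 0); rewrite ED2 lte_fin.
have AD : (A1 * A2 = D1 * D2)%R.
  by have := LE 0%:R 0%:R; rewrite EA1 EA2 ED1 ED2 -!EFinM => -[].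
have L0 a n : unit_density a -> 0 <= laplace_conv_unit a n.
  by move=> [_ a0 _ _]; apply: integral_ge0 => s _; exact: expRM_conv_ge0.
have A10 : (0 <= A1)%R by rewrite -lee_fin -EA1; exact: L0.
have A20 : (0 <= A2)%R by rewrite -lee_fin -EA2; exact: L0.
have DDp : (0 < D1 * D2)%R by exact: mulr_gt0.
(* Positivity passes from the [d] side to the [a] side through [A1 A2 = D1 D2 > 0]. *)
have A1p : (0 < A1)%R.
  by rewrite lt0r A10 andbT; apply/negP => /eqP A1E; move: DDp; rewrite -AD A1E mul0r ltxx.
have A2p : (0 < A2)%R.
  by rewrite lt0r A20 andbT; apply/negP => /eqP A2E; move: DDp; rewrite -AD A2E mulr0 ltxx.
have H1 : \forall t \ae mu, (t < 1)%R -> a1 t = (Num.sqrt (D2 / A2) * d1 t)%R.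
  apply: unit_density_scaling => //; first exact: divr_gt0.
  move=> n; have := LE n%:R 0%:R; rewrite EA2 ED2.
  have [u ->] := fn a1 n ad1; have [v ->] := fn d1 n dd1.
  rewrite -!EFinM => -[uv]; congr EFin.
  by rewrite mulrAC -(mulrC v) -uv mulfK// gt_eqF.
have H2 : \forall t \ae mu, (t < 1)%R -> a2 t = (Num.sqrt (D1 / A1) * d2 t)%R.
  apply: unit_density_scaling => //; first exact: divr_gt0.
  move=> n; have := LE 0%:R n%:R; rewrite EA1 ED1.
  have [u ->] := fn a2 n ad2; have [v ->] := fn d2 n dd2.
  rewrite -!EFinM => -[uv]; congr EFin.
  by rewrite mulrAC -uv mulrC mulKf// gt_eqF.
(* The scaling identities hold only for [t < 1]; the edges of the square at 1 are null. *)
have H3 : \forall t \ae mu, (t != 1)%R.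
  exists [set 1%R]; split => //; first exact: lebesgue_measure_set1.
  by move=> t /= /negP; rewrite negbK => /eqP.
(* Under the root stands [D1 D2] over [A1 A2], which is 1 by [AD]. *)
have cc : (Num.sqrt (D2 / A2) * Num.sqrt (D1 / A1) = 1)%R.
  rewrite -sqrtrM ?divr_ge0 ?ltW//.
  by rewrite mulrACA -invfM (mulrC A2) AD (mulrC D2) divff ?sqrtr1// gt_eqF.
have H12 : \forall s \ae mu2, (s.1 < 1)%R -> (s.2 < 1)%R ->
    (a1 s.1 * a2 s.2 = d1 s.1 * d2 s.2)%R.
  move: (ae_fst _ H1) (ae_snd _ H2).
  apply: (@filterS2 _ _ (ae_filter_ringOfSetsType mu2)).
  move=> s h1 h2 s1 s2; rewrite h1// h2//.
  by rewrite mulrACA cc mul1r.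
move: (ae_fst _ H3) (ae_snd _ H3) H12.
apply: (@filterS3 _ _ (ae_filter_ringOfSetsType mu2)).
move=> s s1 s2 H [/= /itvP t1 /itvP t2]; apply: H.
  by rewrite lt_neqAle s1 t1.
by rewrite lt_neqAle s2 t2.
Qed.

End uniqueness.

Theorem theorem3 (R : realType) (y xdag : R * R -> R)
    (hy : L2_square y)
    (hxdag : nonneg_factored_solution y xdag)
    (hsupp : origin_in_supp xdag) :
  forall x : R * R -> R,
    nonneg_factored_solution y x ->
    x = xdag %[ae leb2 R in @unit_square R].
Proof.
(* Replacing the factors by densities is done once for an arbitrary solution, then used for both [x]
   and [xdag]. *)
have factor (x : R * R -> R) : nonneg_factored_solution y x ->
    exists a1 a2, [/\ unit_density a1, unit_density a2,
      x = (fun t => a1 t.1 * a2 t.2) %[ae leb2 R in @unit_square R] &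
      (fun s => fine (conv a1 s.1) * fine (conv a2 s.2)) = y
        %[ae leb2 R in @unit_square R]].
  move=> [[[xL _] xy] [x1 [x2 [[x1L x2L x12] x10 x20]]]].
  have [a1 ad1 xa1] := unit_density_of_L2 _ x1L x10.
  have [a2 ad2 xa2] := unit_density_of_L2 _ x2L x20.
  have xa : x = (fun t => a1 t.1 * a2 t.2) %[ae leb2 R in @unit_square R].
    move: (ae_fst _ xa1) (ae_snd _ xa2) x12.
    apply: (@filterS3 _ _ (ae_filter_ringOfSetsType (leb2 R))).
    move=> t h1 h2 h tI; have [/= /itvP t1 /itvP t2] := tI.
    by rewrite h// h1 ?h2 ?t1 ?t2.
  exists a1, a2; split => //.
  move: xy; apply: filterS; first exact: (ae_filter_ringOfSetsType (leb2 R)).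
  move=> s xs ss; rewrite -xs// -(autoconv_factor x a1 a2)//.
  by move: xL; rewrite inE => /andP[]; rewrite inE.
move=> x /factor[a1 [a2 [ad1 ad2 xa ay]]].
have [d1 [d2 [dd1 dd2 xd dy]]] := factor _ hxdag.
have ds1 := origin_in_supp_fst _ _ _ dd1 hsupp xd.
have ds2 := origin_in_supp_snd _ _ _ dd2 hsupp xd.
have cE : (fun s => fine (conv a1 s.1) * fine (conv a2 s.2)) =
    (fun s => fine (conv d1 s.1) * fine (conv d2 s.2))
    %[ae leb2 R in @unit_square R].
  move: ay dy; apply: (@filterS2 _ _ (ae_filter_ringOfSetsType (leb2 R))).
  by move=> s h1 h2 ss; rewrite h1// h2.
have := tensor_autoconvolution_unique _ _ _ _ ad1 ad2 dd1 dd2 ds1 ds2 cE.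
move: xa xd; apply: (@filterS3 _ _ (ae_filter_ringOfSetsType (leb2 R))).
by move=> s h1 h2 h3 ss; rewrite h1// h3// h2.
Qed.
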